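(* Let $X$ be a random finite set (RFS) defined on the state space $\mathbb{X}$ with multi-object density $\pi(X)$, let $\mathbb{W}\subseteq\mathbb{X}$, and let $\mathbb{V}=\mathbb{X}\setminus\mathbb{W}$. Then the (marginal) multi-object density of the random finite set $X_W=X\cap\mathbb{W}$ is given by $$\pi_W(X)=[1_{\mathbb{W}}]^{X}\int_{\mathbb{V}}\pi(X\cup X')\,\delta X',$$ where $$\int_{\mathbb{V}}\pi(X\cup X')\,\delta X'=\sum_{n'=0}^{+\infty}\frac{1}{n'!}\int_{\mathbb{V}^{n'}}\pi\big(X\cup\{x'_1,\dots,x'_{n'}\}\big)\,d(x'_1,\dots,x'_{n'}).$$
   Context: A random finite set (RFS) on $\mathbb{X}$ is a random variable taking values in the finite subsets $\mathcal{F}(\mathbb{X})$ of $\mathbb{X}$ (where $\mathbb{X}$ is a Euclidean state space with Lebesgue measure). Its multi-object density is a function $\pi:\mathcal{F}(\mathbb{X})\to[0,\infty)$ in the sense of finite set statistics (FISST): for measurable $A\subseteq\mathbb{X}$, $\Pr(X\subseteq A)=\int_A\pi(X)\,\delta X$, where the set integral is $\int_A f(X)\,\delta X=\sum_{n=0}^{\infty}\frac{1}{n!}\int_{A^n}f(\{x_1,\dots,x_n\})\,dx_1\cdots dx_n$ (the $n=0$ term being $f(\emptyset)$); in particular $\int_{\mathbb{X}}\pi(X)\,\delta X=1$. The indicator function $1_{\mathbb{W}}(x)$ equals $1$ if $x\in\mathbb{W}$ and $0$ otherwise. For a function $h$ on $\mathbb{X}$ and finite $X$, $[h]^X=\prod_{x\in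 X}h(x)$, with $[h]^{\emptyset}=1$. *)

(* Defs.v *)
From HB Require Import structures.
From mathcomp Require Import all_boot all_order all_algebra finmap.
From mathcomp Require Import all_classical all_reals all_analysis.

Set Implicit Arguments.
Unset Strict Implicit.
Unset Printing Implicit Defensive.
Import Order.TTheory GRing.Theory Num.Theory.

Local Open Scope classical_set_scope.
Local Open Scope ring_scope.
Local Open Scope ereal_scope.

Section power_measure.
Context {d} {T : measurableType d} {R : realType}.

Definition cons_pair n (p : T * n.-tuple T) : n.+1.-tuple T :=
  [tuple of p.1 :: p.2].

Lemma measurable_cons_pair n : measurable_fun [set: T * n.-tuple T] (@cons_pair n).
Proof. exact: measurable_cons. Qed.

(* The n-fold product of mu, on n.-tuple T with its product sigma-algebra; see
   power_measure_box. *)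
Fixpoint power_measure (mu : set T -> \bar R) n : set (n.-tuple T) -> \bar R :=
  match n with
  | 0%N => dirac [tuple]
  | m.+1 => pushforward (mu \x @power_measure mu m) (@cons_pair m)
  end.

End power_measure.
Arguments power_measure {d T R} mu n _.

Section power_measure_sigma_finite.
Context {d} {T : measurableType d} {R : realType}.
Variable mu : {sigma_finite_measure set T -> \bar R}.

Let cons_pushforward_sigma_finite n
    (m : {sigma_finite_measure set (n.-tuple T) -> \bar R}) :
  sigma_finite [set: n.+1.-tuple T] (pushforward (mu \x m) (@cons_pair _ T n)).
Proof.
pose g (t : n.+1.-tuple T) : T * n.-tuple T := (thead t, [tuple of behead t]).
have mg : measurable_fun [set: n.+1.-tuple T] g.
  apply/measurable_fun_pairP; split; last exact: measurable_behead.
  exact: (measurable_tnth ord0).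
have /sigma_finiteP[F [FT ndF Foo]] := sigma_finiteT mu.
have /sigma_finiteP[G [GT ndG Goo]] := sigma_finiteT m.
exists (fun k => g @^-1` (F k `*` G k)).
  apply/seteqP; split => // t _.
  have : [set: T] (g t).1 by []; rewrite FT => -[i _ Fi].
  have : [set: n.-tuple T] (g t).2 by []; rewrite GT => -[j _ Gj].
  exists (maxn i j) => //; split.
    by move: (g t).1 Fi; exact/subsetPset/ndF/leq_maxl.
  by move: (g t).2 Gj; exact/subsetPset/ndG/leq_maxr.
move=> k; have [mF Fk] := Foo k; have [mG Gk] := Goo k; split.
  by rewrite -[X in measurable X]setTI; apply: mg => //; exact: measurableX.
rewrite /pushforward -comp_preimage (_ : g \o _ = id).
  by rewrite preimage_id product_measure1E// lte_mul_pinfty// ge0_fin_numE.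
apply/funext => -[x t]; rewrite /g /cons_pair/=; congr pair.
by apply/val_inj.
Qed.

Let cons_pushforward n (m : {sigma_finite_measure set (n.-tuple T) -> \bar R}) :=
  pushforward (mu \x m) (@cons_pair _ T n).

Let cons_pushforward_measure n m :
  exists m' : {sigma_finite_measure set (n.+1.-tuple T) -> \bar R},
    cons_pushforward m = m' :> (set _ -> _).
Proof.
have mc := @measurable_cons_pair _ T n.
pose m0 : {measure set (n.+1.-tuple T) -> \bar R} :=
  measure_function_pushforward__canonical__measure_function_Measure (mu \x m) mc.
pose sf := Measure_isSigmaFinite.Build _ _ _ m0 (cons_pushforward_sigma_finite m).
pose m1 : {sigma_finite_measure set (n.+1.-tuple T) -> \bar R} :=
  HB.pack (m0 : set _ -> \bar R) (Measure.class m0) sf.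
by exists m1.
Qed.

Let power_measure_ex n :
  exists m : {sigma_finite_measure set (n.-tuple T) -> \bar R},
    power_measure mu n = m :> (set _ -> _).
Proof.
elim: n => [|n [m IH]]; first by exists (dirac [tuple]).
have [m' m'E] := cons_pushforward_measure m.
by exists m'; rewrite /= IH; exact: m'E.
Qed.

Let power_measure0 n : power_measure mu n set0 = 0.
Proof. by have [m ->] := power_measure_ex n. Qed.

Let power_measure_ge0 n A : 0 <= power_measure mu n A.
Proof. by have [m ->] := power_measure_ex n. Qed.

Let power_measure_sigma_additive n : semi_sigma_additive (power_measure mu n).
Proof.
by have [m ->] := power_measure_ex n; exact: measure_semi_sigma_additive.
Qed.

HB.instance Definition _ n := isMeasure.Build _ _ _ (power_measure mu n)
  (@power_measure0 n) (@power_measure_ge0 n) (@power_measure_sigma_additive n).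

Let power_measure_sigma_finite n : sigma_finite setT (power_measure mu n).
Proof. by have [m ->] := power_measure_ex n; exact: sigma_finiteT. Qed.

HB.instance Definition _ n := Measure_isSigmaFinite.Build _ _ _
  (power_measure mu n) (@power_measure_sigma_finite n).

Lemma power_measure_box n (A : 'I_n -> set T) : (forall i, measurable (A i)) ->
  power_measure mu n [set t | forall i, A i (tnth t i)] = \prod_(i < n) mu (A i).
Proof.
elim: n A => [|n IH] A mA.
  rewrite big_ord0 /= diracE (_ : [set _ | _] = setT) ?in_setT//.
  by apply/seteqP; split => // t _ [].
rewrite big_ord_recl -IH//= /pushforward.
rewrite (_ : _ @^-1` _ =
  A ord0 `*` [set t : n.-tuple T | forall i, A (lift ord0 i) (tnth t i)]).
  rewrite product_measure1E// (_ : mkset _ =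
    \bigcap_(i in [set: 'I_n]) (fun t => tnth t i) @^-1` A (lift ord0 i)).
    apply: fin_bigcap_measurable => // i _.
    by rewrite -[X in measurable X]setTI; exact: measurable_tnth.
  by apply/seteqP; split => t /= h i; [move=> _; exact: h|exact: h].
apply/seteqP; split=> -[x t]/=.
  move=> h; split; first exact: (h ord0).
  by move=> i; have := h (lift ord0 i); rewrite /cons_pair tnthS.
move=> [Ax At] i; case: (unliftP ord0 i) => [j|] ->; last by [].
by rewrite /cons_pair tnthS.
Qed.

End power_measure_sigma_finite.

Section euclidean_space.
Variables (R : realType) (d : nat).

Definition euclidean := d.-tuple (measurableTypeR R).

Definition lebesgue : set euclidean -> \bar R := power_measure lebesgue_measure d.

HB.instance Definition _ := SigmaFiniteMeasure.on lebesgue.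

End euclidean_space.
Arguments lebesgue {R d}.

Section finite_subsets.
Context {d} {T : measurableType d}.

Definition fset_of_tuple n (t : n.-tuple T) : {fset T} := [fset x in tval t]%fset.

Definition fset_restr (W : set T) (Y : {fset T}) : {fset T} :=
  [fset x in Y | x \in W]%fset.

Definition counting_events : set (set {fset T}) :=
  [set B | exists2 A : set T, measurable A &
    exists n, B = [set Y | #|` fset_restr A Y| = n]].

End finite_subsets.

(* The finite subsets of T, with the sigma-algebra generated by the counting
   maps Y |-> #|Y `&` A| for A measurable. *)
Definition fin_subsets d (T : measurableType d) :=
  g_sigma_algebraType (@counting_events d T).

Section restriction.
Context {d} {T : measurableType d}.

Lemma measurable_fset_restr (W : set T) : measurable W ->
  measurable_fun [set: fin_subsets T] (fset_restr W : fin_subsets T -> fin_subsets T).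
Proof.
move=> mW.
apply: (@measurability _ _ (fin_subsets T) (fin_subsets T) setT (fset_restr W)
  (@counting_events _ T)) => //.
move=> _ [_ [A mA [n ->]] <-]; rewrite setTI; apply: sub_sigma_algebra.
exists (W `&` A); first exact: measurableI.
exists n; apply/seteqP; split => Y /= <-; congr (#|` _|)%fset;
  by apply/fsetP => x; rewrite !inE/= in_setI andbA.
Qed.

Context {dO} {Omega : measurableType dO}.
Variables (W : set T) (mW : measurable W) (X : {mfun Omega >-> fin_subsets T}).

(* The unused measurability proof is what the instance below is keyed on. *)
Definition rfs_restr (_ : measurable W) : Omega -> fin_subsets T :=
  fun w => fset_restr W (X w).

Let measurable_rfs_restr : measurable_fun setT (rfs_restr mW).
Proof.
by apply: (measurableT_comp (measurable_fset_restr mW)); exact: measurable_funP.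
Qed.

HB.instance Definition _ :=
  isMeasurableFun.Build _ _ _ _ (rfs_restr mW) measurable_rfs_restr.

End restriction.
Arguments rfs_restr {d T dO Omega W} X _ _.

Section multiobject_density.
Context {d} {T : measurableType d} {R : realType}.
Variable mu : set T -> \bar R.

(* Repeated points in (t_1, ..., t_n) collapse in the set {t_1, ..., t_n}. *)
Definition set_integral (A : set T) (f : {fset T} -> \bar R) : \bar R :=
  \sum_(0 <= n <oo) ((n`!%:R)^-1)%:E *
    \int[power_measure mu n]_(t in [set t | forall i, A (tnth t i)])
      f (fset_of_tuple t).

Context {dO} {Omega : measurableType dO} (P : probability Omega R).

(* The measurability clause is what makes every term of the set integrals of
   f well defined. *)
Definition is_multiobject_density (X : {RV P >-> fin_subsets T}) (f : {fset T} -> R) :=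
  [/\ forall Y, (0 <= f Y)%R,
      forall n, measurable_fun [set: n.-tuple T] (fun t => f (fset_of_tuple t)) &
      forall A, measurable A ->
        P [set w | [set` X w] `<=` A] = set_integral A (EFin \o f)].

End multiobject_density.
Arguments is_multiobject_density {d T R} mu {dO Omega} P X f.

(* Main.v *)
(* Let J_A f (Y) be the integral over x in A of f({x} u Y).  The integral of
   f(Y u {t_1, ..., t_n}) over A^n is J_A^n f (Y), so the set integral over A of
   f(Y u .) is exp(J_A) f (Y).  By Tonelli the operators J_A and J_B commute, and
   J_(A u B) = J_A + J_B for disjoint A and B; hence exp(J_(A u B)) =
   exp(J_A) exp(J_B).  Since X n W is included in A iff X is included in
   (A n W) u V, the set integral of pi over (A n W) u V splits into an outer one
   over A n W and the inner one over V that defines pi_W.  Almost everywhere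
   finiteness of pi_W follows from its total set integral being 1. *)
Require Import Defs.
From HB Require Import structures.
From mathcomp Require Import all_boot all_order all_algebra finmap.
From mathcomp Require Import all_classical all_reals all_analysis.
From mathcomp Require Import measurable_realfun.

Import Order.TTheory GRing.Theory Num.Theory.

Local Open Scope classical_set_scope.
Local Open Scope ring_scope.
Local Open Scope ereal_scope.

Set Implicit Arguments.
Unset Strict Implicit.
Unset Printing Implicit Defensive.

(** * Binomial sums and Cauchy products of nonnegative series *)

Lemma pascal_sum (V : nmodType) (b : nat -> nat -> V) n :
  (\sum_(i < n.+1) b i.+1 (n - i)%N *+ 'C(n, i) +
   \sum_(i < n.+1) b i (n - i).+1 *+ 'C(n, i) =
   \sum_(i < n.+2) b i (n.+1 - i)%N *+ 'C(n.+1, i))%R.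
Proof.
rewrite [RHS]big_ord_recl/= bin0 [X in (_ + X)%R]big_ord_recl/= bin0 !subn0.
rewrite addrCA; congr (_ + _)%R.
under [RHS]eq_bigr => i _ do rewrite binS mulrnDr subSS.
rewrite big_split/= addrC; congr (_ + _)%R.
(* The remaining sums differ by the term [i = n] only, whose coefficient ['C(n, n.+1)] is 0. *)
rewrite [RHS]big_ord_recr/= bin_small// mulr0n addr0.
by apply: eq_bigr => i _; rewrite subnSK.
Qed.

(* The Nmodule operation [*+] and the one of ereal_scope are distinct constants. *)
Lemma natmul_mule (R : realType) (x : \bar R) n : (x *+ n)%R = n%:R%:E * x.
Proof. by rewrite mule_natl. Qed.

(** Padding the triangle [i <= n] with zeros, in the array [b], gives a full double series, whose
    two sums interchange by nonnegativity; for fixed [i] the shift [n = i + j] recovers row [i] of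
    [a]. *)
Lemma nneseries_diagonal (R : realType) (a : nat -> nat -> \bar R) :
  (forall i j, 0 <= a i j) ->
  \sum_(0 <= n <oo) \sum_(i < n.+1) a i (n - i)%N =
  \sum_(0 <= i <oo) \sum_(0 <= j <oo) a i j.
Proof.
move=> a0.
pose b n i := if (i <= n)%N then a i (n - i)%N else 0.
have b0 n i : 0 <= b n i by rewrite /b; case: ifP.
transitivity (\sum_(0 <= n <oo) \sum_(0 <= i <oo) b n i).
  apply: eq_eseriesr => n _.
  rewrite (nneseries_split 0 n.+1)//= add0n eseries0 ?adde0.
    by rewrite big_mkord; apply: eq_bigr => i _; rewrite /b -ltnS ltn_ord.
  by move=> i ni _; rewrite /b leqNgt ni.
rewrite nneseries_interchange//; apply: eq_eseriesr => i _.
rewrite (nneseries_split 0 i)//= add0n big1_seq ?add0e.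
  rewrite -nneseries_addn//; apply: eq_eseriesr => j _.
  by rewrite /b leq_addl addnK.
by move=> j; rewrite mem_index_iota => /andP[_ /andP[_ ji]]; rewrite /b leqNgt ji.
Qed.

(** * Tonelli's theorem on a rectangle, by extension by zero *)

Lemma integral_prod_patch d1 d2 (T1 : measurableType d1) (T2 : measurableType d2)
    (R : realType) (m1 : {sigma_finite_measure set T1 -> \bar R})
    (m2 : {sigma_finite_measure set T2 -> \bar R}) (A : set T1) (B : set T2)
    (h : T1 * T2 -> \bar R) :
  \int[m1]_(x in A) \int[m2]_(y in B) h (x, y) =
  \int[m1]_x \int[m2]_y (h \_ (A `*` B)) (x, y).
Proof.
rewrite integral_mkcond; apply: eq_integral => x _; rewrite patchE.
case: ifPn => xA.
  rewrite integral_mkcond; apply: eq_integral => y _.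
  by rewrite !patchE in_setX xA.
by rewrite integral0_eq// => y _; rewrite patchE in_setX (negbTE xA).
Qed.

Lemma fubini_tonelli_on d1 d2 (T1 : measurableType d1) (T2 : measurableType d2)
    (R : realType) (m1 : {sigma_finite_measure set T1 -> \bar R})
    (m2 : {sigma_finite_measure set T2 -> \bar R}) (A : set T1) (B : set T2)
    (h : T1 * T2 -> \bar R) :
  measurable A -> measurable B -> measurable_fun [set: T1 * T2] h -> (forall z, 0 <= h z) ->
  \int[m1]_(x in A) \int[m2]_(y in B) h (x, y) =
  \int[m2]_(y in B) \int[m1]_(x in A) h (x, y).
Proof.
move=> mA mB mh h0.
rewrite integral_prod_patch fubini_tonelli//.
(* The right-hand side is patched by the same lemma, applied to [h] with its arguments swapped. *)
- rewrite (integral_prod_patch _ _ B A (fun z => h (z.2, z.1))).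
  apply: eq_integral => y _; apply: eq_integral => x _.
  by rewrite !patchE !in_setX andbC.
- by apply/(measurable_restrictT _ _).1; [exact: measurableX|exact: measurable_funTS].
- by move=> z; rewrite patchE; case: ifP.
Qed.

(** * Integrals over powers of a set, and measurability through tuples *)

Section powers.
Context {d} {T : measurableType d} {R : realType}.
Variable mu : {sigma_finite_measure set T -> \bar R}.
Implicit Types (A B W : set T) (Y : {fset T}) (f g : {fset T} -> \bar R).

(** This is literally the domain of integration in [set_integral], so that the two forms are
    exchanged by conversion. *)
Definition box A n : set (n.-tuple T) := [set t | forall i, A (tnth t i)].
Arguments box : clear implicits.

Lemma measurable_box A n : measurable A -> measurable (box A n).
Proof.
move=> mA; rewrite (_ : box A n =
    \bigcap_(i in [set: 'I_n]) (fun t => tnth t i) @^-1` A).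
  apply: fin_bigcap_measurable => // i _.
  by rewrite -[X in measurable X]setTI; exact: measurable_tnth.
by apply/seteqP; split => t /= h i; [move=> _; exact: h|exact: h].
Qed.

Lemma preimage_cons_box A n : @cons_pair _ T n @^-1` box A n.+1 = A `*` box A n.
Proof.
apply/seteqP; split=> -[x t]/=.
  move=> h; split; first exact: (h ord0).
  by move=> i; have := h (lift ord0 i); rewrite /cons_pair tnthS.
move=> [Ax At] i; case: (unliftP ord0 i) => [j|] ->; last by [].
by rewrite /cons_pair tnthS; exact: At.
Qed.

Lemma integral_power0 A (h : 0.-tuple T -> \bar R) : measurable A ->
  measurable_fun setT h ->
  \int[power_measure mu 0]_(t in box A 0) h t = h [tuple].
Proof.
move=> mA mh; rewrite integral_dirac//; last exact: measurable_funTS.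
  (* The empty tuple lies in [box A 0] vacuously, so the Dirac mass there has weight 1. *)
  by rewrite diracE mem_set ?mul1e// => -[].
exact: measurable_box.
Qed.

(** The power measure is an image under [cons_pair]: a change of variables brings the integral to
    the product space, and Tonelli's theorem peels off the first coordinate. *)
Lemma integral_powerS A n (h : n.+1.-tuple T -> \bar R) : measurable A ->
  measurable_fun setT h -> (forall t, 0 <= h t) ->
  \int[power_measure mu n.+1]_(t in box A n.+1) h t =
  \int[mu]_(x in A) \int[power_measure mu n]_(t in box A n) h (cons_pair (x, t)).
Proof.
move=> mA mh h0.
transitivity (\int[pushforward (mu \x power_measure mu n) (@cons_pair _ T n)]_(t in
    box A n.+1) h t); first by [].
rewrite (ge0_integral_pushforward (@measurable_cons_pair _ T n))//; last 2 first.
- exact: measurable_box.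
- exact: measurable_funTS.
rewrite preimage_cons_box integral_mkcond fubini_tonelli1//.
- exact: esym (integral_prod_patch _ _ _ _ (h \o @cons_pair _ T n)).
- apply/(measurable_restrictT _ _).1.
    by apply: measurableX => //; exact: measurable_box.
  by apply: measurable_funTS; apply: measurableT_comp => //; exact: measurable_cons_pair.
- by move=> z; rewrite patchE; case: ifP => //= _; exact: h0.
Qed.

Lemma fset_of_cons n x (t : n.-tuple T) :
  fset_of_tuple (cons_pair (x, t)) = (x |` fset_of_tuple t)%fset.
Proof. by apply/fsetP => y; rewrite !inE. Qed.

Lemma fset_of_nil : @fset_of_tuple _ T 0 [tuple] = fset0.
Proof. by apply/fsetP => y; rewrite !inE. Qed.

Lemma fset_of_tuple_surj Y : exists n (t : n.-tuple T), Y = fset_of_tuple t.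
Proof. by exists (size Y), (in_tuple Y); apply/fsetP => y; rewrite !inE. Qed.

(* {fset T} carries no sigma-algebra here: measurability is that of all the pullbacks of f
   to tuples. *)
Definition fset_measurable f := forall n,
  measurable_fun [set: n.-tuple T] (fun t => f (fset_of_tuple t)).

Definition ge0_fset_measurable f := (forall Y, 0 <= f Y) /\ fset_measurable f.

Lemma measurable_insert f Y : fset_measurable f ->
  measurable_fun [set: T] (fun x => f (x |` Y)%fset).
Proof.
move=> mf; have [n [t ->]] := fset_of_tuple_surj Y.
under eq_fun do rewrite -fset_of_cons.
apply: (measurableT_comp (mf _)).
by apply: (measurableT_comp (@measurable_cons_pair _ T n)); exact: measurable_pair2.
Qed.

Lemma measurable_insert2 f Y : fset_measurable f ->
  measurable_fun [set: T * T] (fun z => f (z.1 |` (z.2 |` Y))%fset).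
Proof.
move=> mf; have [n [t ->]] := fset_of_tuple_surj Y.
under eq_fun do rewrite -!fset_of_cons.
apply: (measurableT_comp (mf _)).
apply: (measurableT_comp (@measurable_cons_pair _ T n.+1)).
apply: measurable_fun_pair => //.
by apply: (measurableT_comp (@measurable_cons_pair _ T n)); exact: measurable_fun_pair.
Qed.

Lemma measurable_insert_tuple f n : fset_measurable f ->
  measurable_fun [set: n.-tuple T * T] (fun z => f (z.2 |` fset_of_tuple z.1)%fset).
Proof.
move=> mf; under eq_fun do rewrite -fset_of_cons.
apply: (measurableT_comp (mf _)).
by apply: (measurableT_comp (@measurable_cons_pair _ T n)) => //; exact: measurable_swap.
Qed.

Lemma measurable_union_tuple f Y n : fset_measurable f ->
  measurable_fun [set: n.-tuple T] (fun t => f (Y `|` fset_of_tuple t)%fset).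
Proof.
move=> mf; have [m [s ->]] := fset_of_tuple_surj Y.
have -> : (fun t => f (fset_of_tuple s `|` fset_of_tuple t)%fset) =
          (fun t : n.-tuple T => f (fset_of_tuple [tuple of s ++ t])).
  by apply/funext => t; congr f; apply/fsetP => y; rewrite !inE.
apply: (measurableT_comp (mf _)); apply/measurable_fun_tnthP => i.
(* Measurability is checked by coordinates: those of [s ++ t] are constant on the part [s] and
   projections of [t] on the rest. In both cases [x0] is a mere default for [nth]. *)
case: (splitP i) => j ij.
  rewrite (_ : _ \o _ = cst (tnth s j))//; apply/funext => t /=.
  by have x0 := tnth s j; rewrite !(tnth_nth x0)/= nth_cat ij size_tuple ltn_ord.
rewrite (_ : _ \o _ = fun t => tnth t j); first exact: measurable_tnth.
apply/funext => t /=; have x0 := tnth t j; rewrite !(tnth_nth x0)/= nth_cat ij size_tuple.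
by rewrite ltnNge leq_addr/= addKn.
Qed.

End powers.
Arguments box {d T} A n _.

(** * The operators J_A, their powers and their exponentials *)

Section point_integral.
Context {d} {T : measurableType d} {R : realType}.
Variable mu : {sigma_finite_measure set T -> \bar R}.
Implicit Types (A B W : set T) (Y : {fset T}) (f g : {fset T} -> \bar R).

Definition point_integral A f : {fset T} -> \bar R :=
  fun Y => \int[mu]_(x in A) f (x |` Y)%fset.

Local Notation J := point_integral.

(** Along tuples, [J A f] integrates out one variable of a jointly measurable function of (t, x),
    which leaves a measurable function of t by Tonelli's theorem. *)
Lemma point_integral_ge0_measurable A f : measurable A ->
  ge0_fset_measurable f -> ge0_fset_measurable (J A f).
Proof.
move=> mA [f0 mf]; split; first by move=> Y; exact: integral_ge0.
move=> n; pose h (z : n.-tuple T * T) := f (z.2 |` fset_of_tuple z.1)%fset.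
rewrite (_ : (fun t => _) = fubini_F mu (h \_ (setT `*` A))).
  apply: measurable_fun_fubini_tonelli_F.
    apply/(measurable_restrictT _ _).1; first exact: measurableX.
    by apply: measurable_funTS; exact: measurable_insert_tuple.
  by move=> z; rewrite patchE; case: ifP => // _; exact: f0.
apply/funext => t; rewrite /point_integral /fubini_F [LHS]integral_mkcond.
by apply: eq_integral => x _; rewrite !patchE in_setX in_setT.
Qed.

Lemma iter_point_integral_ge0_measurable n A f : measurable A ->
  ge0_fset_measurable f -> ge0_fset_measurable (iter n (J A) f).
Proof.
by move=> mA mf; elim: n => [//|n IH]; exact: point_integral_ge0_measurable.
Qed.

Lemma point_integralC A B f : measurable A -> measurable B ->
  ge0_fset_measurable f -> J A (J B f) = J B (J A f).
Proof.
move=> mA mB [f0 mf]; apply/funext => Y; rewrite /point_integral.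
pose h (z : T * T) := f (z.1 |` (z.2 |` Y))%fset.
have := @fubini_tonelli_on _ _ _ _ _ mu mu A B h mA mB
  (measurable_insert2 _ mf) (fun z => f0 _).
rewrite /h/= => <-.
(* The order in which x and y are inserted in Y is immaterial, so both sides integrate the same
   function. *)
by under eq_integral => x _ do under eq_integral => y _ do rewrite fsetUCA.
Qed.

Lemma iter_point_integralC n A B f : measurable A -> measurable B ->
  ge0_fset_measurable f -> J B (iter n (J A) f) = iter n (J A) (J B f).
Proof.
move=> mA mB mf; elim: n => [//|n IH].
by rewrite !iterS -IH point_integralC//; exact: iter_point_integral_ge0_measurable.
Qed.

Lemma point_integralU A B f Y : measurable A -> measurable B ->
  [disjoint A & B] -> ge0_fset_measurable f ->
  J (A `|` B) f Y = J A f Y + J B f Y.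
Proof.
move=> mA mB AB [f0 mf]; rewrite /point_integral ge0_integral_setU//.
by apply: measurable_funTS; exact: measurable_insert.
Qed.

Lemma point_integral_sum A n (F : nat -> {fset T} -> \bar R) (k : nat -> nat) Y :
  measurable A -> (forall i, ge0_fset_measurable (F i)) ->
  J A (fun Y => \sum_(i < n) F i Y *+ k i)%R Y =
  (\sum_(i < n) J A (F i) Y *+ k i)%R.
Proof.
move=> mA mF; rewrite /point_integral ge0_integral_sum//.
- apply: eq_bigr => i _; under eq_integral do rewrite natmul_mule.
  rewrite ge0_integralZl_EFin ?natmul_mule//.
  + by move=> x _; exact: (mF i).1.
  + by apply: measurable_funTS; apply: measurable_insert; exact: (mF i).2.
- move=> i; under eq_fun do rewrite natmul_mule; apply: measurable_funTS.
  by apply: measurable_funeM; apply: measurable_insert; exact: (mF i).2.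
- by move=> i x _; rewrite natmul_mule mule_ge0//; exact: (mF i).1.
Qed.

(* Binomial theorem for the commuting operators J A and J B. *)
Lemma iter_point_integralU n A B f Y : measurable A -> measurable B ->
  [disjoint A & B] -> ge0_fset_measurable f ->
  iter n (J (A `|` B)) f Y =
  (\sum_(i < n.+1) iter i (J A) (iter (n - i) (J B) f) Y *+ 'C(n, i))%R.
Proof.
move=> mA mB AB mf; pose a i j := iter i (J A) (iter j (J B) f).
have ma i j : ge0_fset_measurable (a i j).
  by do 2 apply: iter_point_integral_ge0_measurable => //.
elim: n Y => [|n IH] Y; first by rewrite big_ord1.
rewrite iterS point_integralU//; last first.
  by apply: iter_point_integral_ge0_measurable => //; exact: measurableU.
rewrite (funext IH).
rewrite (@point_integral_sum _ n.+1 (fun i => a i (n - i)%N) (fun i => 'C(n, i)))//.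
rewrite (@point_integral_sum _ n.+1 (fun i => a i (n - i)%N) (fun i => 'C(n, i)))//.
rewrite -(pascal_sum (fun i j => a i j Y)); congr (_ + _)%R.
(* The sums carrying an extra [J A] agree by conversion; in the others [J B] has to be moved inwards
   past the [i] copies of [J A]. *)
apply: eq_bigr => i _; congr (_ *+ _)%R; rewrite /a iter_point_integralC//.
exact: iter_point_integral_ge0_measurable.
Qed.

(** Monotone convergence; it lets the powers of [J A] act termwise on the inner series
    [expJ B f]. *)
Lemma point_integral_series A (c : nat -> R) (F : nat -> {fset T} -> \bar R) :
  measurable A -> (forall n, (0 <= c n)%R) -> (forall n, ge0_fset_measurable (F n)) ->
  J A (fun Y => \sum_(0 <= n <oo) (c n)%:E * F n Y) =
  (fun Y => \sum_(0 <= n <oo) (c n)%:E * J A (F n) Y).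
Proof.
move=> mA c0 mF; apply/funext => Y; rewrite /point_integral integral_nneseries//.
- apply: eq_eseriesr => n _; rewrite ge0_integralZl_EFin//.
  + by move=> x _; exact: (mF n).1.
  + by apply: measurable_funTS; apply: measurable_insert; exact: (mF n).2.
- move=> n; apply: measurable_funTS.
  by apply: measurable_funeM; apply: measurable_insert; exact: (mF n).2.
- by move=> n x _; rewrite mule_ge0 ?lee_fin//; exact: (mF n).1.
Qed.

Lemma iter_point_integral_series k A (c : nat -> R) (F : nat -> {fset T} -> \bar R) :
  measurable A -> (forall n, (0 <= c n)%R) -> (forall n, ge0_fset_measurable (F n)) ->
  iter k (J A) (fun Y => \sum_(0 <= n <oo) (c n)%:E * F n Y) =
  (fun Y => \sum_(0 <= n <oo) (c n)%:E * iter k (J A) (F n) Y).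
Proof.
move=> mA c0 mF; elim: k => [//|k IH]; rewrite iterS IH point_integral_series//.
by move=> n; exact: iter_point_integral_ge0_measurable.
Qed.

Definition exp_point_integral A f : {fset T} -> \bar R :=
  fun Y => \sum_(0 <= n <oo) (n`!%:R^-1)%:E * iter n (J A) f Y.

Local Notation expJ := exp_point_integral.

Lemma exp_point_integral_ge0_measurable A f : measurable A ->
  ge0_fset_measurable f -> ge0_fset_measurable (expJ A f).
Proof.
move=> mA mf; have mJ n := iter_point_integral_ge0_measurable n mA mf.
have c0 n Y : 0 <= (n`!%:R^-1)%:E * iter n (J A) f Y.
  by rewrite mule_ge0//; exact: (mJ n).1.
split=> [Y|n]; first exact: nneseries_ge0.
by apply: ge0_emeasurable_sum => // k _; apply: measurable_funeM; exact: (mJ k).2.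
Qed.

Lemma exp_point_integralU A B f : measurable A -> measurable B ->
  [disjoint A & B] -> ge0_fset_measurable f ->
  expJ (A `|` B) f = expJ A (expJ B f).
Proof.
move=> mA mB AB mf; apply/funext => Y; rewrite /exp_point_integral.
(* The general term of the double series [expJ A (expJ B f) Y]; the binomial theorem turns the
   left-hand side into its sum by diagonals. *)
pose a i j := ((i`!%:R^-1)%:E * ((j`!%:R^-1)%:E * iter i (J A) (iter j (J B) f) Y)).
have a0 i j : 0 <= a i j.
  rewrite !mule_ge0//; apply: (iter_point_integral_ge0_measurable i mA _).1.
  exact: iter_point_integral_ge0_measurable.
transitivity (\sum_(0 <= n <oo) \sum_(i < n.+1) a i (n - i)%N).
  apply: eq_eseriesr => n _; rewrite iter_point_integralU//.
  rewrite ge0_sume_distrr => [|i _]; last first.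
    rewrite natmul_mule mule_ge0//.
    apply: (iter_point_integral_ge0_measurable i mA _).1.
    exact: iter_point_integral_ge0_measurable.
  apply: eq_bigr => i _; rewrite /a natmul_mule !muleA -!EFinM; congr (_%:E * _).
  (* The coefficients match because C(n, i) / n! = 1 / (i! (n - i)!). *)
  rewrite -(@bin_fact n i) ?natrM; last by rewrite -ltnS.
  have nz m : (0 < m)%N -> m%:R != 0%R :> R by rewrite pnatr_eq0 -lt0n.
  rewrite !invfM mulrAC mulVf ?mul1r// nz// bin_gt0 -ltnS//.
rewrite nneseries_diagonal//; apply: eq_eseriesr => i _.
rewrite iter_point_integral_series//; last first.
  by move=> j; exact: iter_point_integral_ge0_measurable.
rewrite nneseriesZl// => j _; rewrite mule_ge0//.
apply: (iter_point_integral_ge0_measurable i mA _).1.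
exact: iter_point_integral_ge0_measurable.
Qed.

(** Each coordinate of the tuple contributes one [J A]. The induction is over all [Y], since the
    coordinate peeled off is absorbed into [Y]. *)
Lemma integral_box_iter A f n Y : measurable A -> ge0_fset_measurable f ->
  \int[power_measure mu n]_(t in box A n) f (Y `|` fset_of_tuple t)%fset =
  iter n (J A) f Y.
Proof.
move=> mA mf; elim: n Y => [|n IH] Y.
  by rewrite integral_power0 ?fset_of_nil ?fsetU0//; exact: measurable_union_tuple mf.2.
rewrite integral_powerS//; last 2 first.
- exact: measurable_union_tuple mf.2.
- by move=> t; exact: mf.1.
rewrite iterS; apply: eq_integral => x _; rewrite -IH.
by apply: eq_integral => t _; rewrite fset_of_cons fsetUCA fsetUA.
Qed.

(** At [Y = fset0] this gives ordinary set integrals; with the complement of W for [A] it gives the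
    inner integral of the marginal density. *)
Lemma set_integral_union A f Y : measurable A -> ge0_fset_measurable f ->
  set_integral mu A (fun Y' => f (Y `|` Y')%fset) = expJ A f Y.
Proof.
by move=> mA mf; apply: eq_eseriesr => n _; congr (_ * _); exact: integral_box_iter.
Qed.

Lemma set_integral_exp A f : measurable A -> ge0_fset_measurable f ->
  set_integral mu A f = expJ A f fset0.
Proof.
move=> mA mf; rewrite -set_integral_union//; congr set_integral.
by apply/funext => Y; rewrite fset0U.
Qed.

End point_integral.

(** * The marginal density *)

Lemma prod_indic_box d (T : measurableType d) (R : realType) (W : set T) n
    (t : n.-tuple T) :
  (\prod_(x <- fset_of_tuple t) \1_W x = \1_(box W n) t :> R)%R.
Proof.
(* Repeated coordinates collapse in the product, harmlessly: a single coordinate outside W makes it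
   vanish, and otherwise every factor is 1. *)
rewrite [RHS]indicE; have [/set_mem tW|tW] := boolP (t \in box W n).
  rewrite big1_seq// => x /andP[_]; rewrite !inE => /tnthP[i ->].
  by rewrite indicE mem_set//; exact: tW.
have [i Wi] : exists i, ~ W (tnth t i).
  by apply/existsNP => h; move: tW; rewrite mem_set.
apply/eqP; rewrite prodf_seq_eq0; apply/hasP; exists (tnth t i).
  by rewrite !inE mem_tnth.
by rewrite indicE memNset//=.
Qed.

Section marginal.
Context {d} {T : measurableType d} {R : realType}.
Variable mu : {sigma_finite_measure set T -> \bar R}.
Context {dO} {Omega : measurableType dO} (P : probability Omega R).
Variables (X : {RV P >-> fin_subsets T}) (pi_X : {fset T} -> R).
Hypothesis hpi_X : is_multiobject_density mu P X pi_X.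
Variables (W : set T) (mW : measurable W) (pi_W : {fset T} -> \bar R).
Hypothesis pi_WE : forall Y : {fset T},
  pi_W Y = (\prod_(x <- Y) \1_W x)%:E *
    set_integral mu (~` W) (fun Y' : {fset T} => (pi_X (Y `|` Y')%fset)%:E).

Let V := ~` W.
Let mV : measurable V. Proof. exact: measurableC. Qed.

Let f_X : ge0_fset_measurable (EFin \o pi_X).
Proof.
have [p0 mp _] := hpi_X; split=> [Y|n]; first by rewrite lee_fin.
by apply/measurable_EFinP; exact: mp.
Qed.

Let f_V : ge0_fset_measurable (exp_point_integral mu V (EFin \o pi_X)).
Proof. exact: exp_point_integral_ge0_measurable. Qed.

(** Along tuples the indicator prefactor becomes a restriction to [box W n], which can then be
    traded for a smaller domain of integration. *)
Let pi_W_patch n : (fun t : n.-tuple T => pi_W (fset_of_tuple t)) =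
  (fun t => exp_point_integral mu V (EFin \o pi_X) (fset_of_tuple t)) \_ (box W n).
Proof.
apply/funext => t; rewrite pi_WE prod_indic_box patchE indicE.
rewrite [X in _ * X](set_integral_union mu (fset_of_tuple t) mV f_X).
by case: ifP; rewrite ?mul1e ?mul0e.
Qed.

Lemma marginal_density_ge0_measurable : ge0_fset_measurable pi_W.
Proof.
split=> [Y|n].
  have [n [t ->]] := fset_of_tuple_surj Y.
  have /(congr1 (fun h => h t)) -> := pi_W_patch n.
  by rewrite patchE; case: ifP => // _; exact: f_V.1.
rewrite pi_W_patch; apply/(measurable_restrictT _ _).1; first exact: measurable_box.
by apply: measurable_funTS; exact: f_V.2.
Qed.

Lemma marginal_set_integral A : measurable A ->
  P [set w | [set` rfs_restr X mW w] `<=` A] = set_integral mu A pi_W.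
Proof.
move=> mA; have mAW : measurable (A `&` W) by exact: measurableI.
have [_ _ hP] := hpi_X.
transitivity (P [set w | [set` X w] `<=` (A `&` W) `|` V]).
  congr (P _); apply/seteqP; split=> w /= h x.
    move=> xX; have [xW|xW] := pselect (W x); last by right.
    by left; split => //; apply: h; rewrite /= !inE/= mem_set// andbT.
  by rewrite /= !inE/= => /andP[xX /set_mem xW]; case: (h _ xX) => // -[].
rewrite hP; last exact: measurableU.
(* Cutting A down to W makes it disjoint from V, as the exponential law requires. *)
have AWV : [disjoint A `&` W & V].
  by apply/disj_setPS => x [[_ Wx]]; exact.
rewrite (set_integral_exp mu _ f_X); last exact: measurableU.
rewrite exp_point_integralU// -set_integral_exp//.
apply: eq_eseriesr => n _; congr (_ * _).
rewrite -[RHS]/(\int[power_measure mu n]_(t in box A n) pi_W (fset_of_tuple t)).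
rewrite -[LHS]/(\int[power_measure mu n]_(t in box (A `&` W) n) _).
(* The restriction moves from the integrand to the domain, where [box A n] meets [box W n] in
   [box (A]&[W) n]. *)
rewrite pi_W_patch -integral_mkcondr; congr (integral _ _ _).
by apply/seteqP; split => [t h|t [h1 h2] i]; [split=> i; case: (h i)|split].
Qed.

(** The integral of [pi_W] over n-tuples, divided by n!, is one term of a nonnegative series with
    sum P(X n W is included in the whole space) = 1. It is therefore finite, and so is the integrand
    almost everywhere. *)
Lemma marginal_density_ae_fin n :
  {ae power_measure mu n, forall t, pi_W (fset_of_tuple t) \is a fin_num}.
Proof.
have [p0 mp] := marginal_density_ge0_measurable.
have foo : \int[power_measure mu n]_t pi_W (fset_of_tuple t) < +oo.
  have c0 k : 0 <= (k`!%:R^-1)%:E * \int[power_measure mu k]_(t in box setT k)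
      pi_W (fset_of_tuple t).
    by rewrite mule_ge0// integral_ge0.
  have : (n`!%:R^-1)%:E * \int[power_measure mu n]_(t in box setT n)
      pi_W (fset_of_tuple t) <= 1.
    apply: (@le_trans _ _ (set_integral mu setT pi_W)); last first.
      rewrite -marginal_set_integral// (_ : [set w | _] = setT) ?probability_setT//.
      by apply/seteqP; split.
    rewrite /set_integral (nneseriesD1 (n:=n))// leeDl// nneseries_ge0//.
  have -> : box setT n = [set: n.-tuple T] by apply/seteqP; split.
  (* An infinite integral would stay infinite after multiplication by the positive constant 1 / n!,
     against the bound 1. *)
  rewrite ltey; apply: contraTneq => ->.
  by rewrite gt0_muley// lte_fin invr_gt0 ltr0n fact_gt0.
have := @integrable_ae _ _ _ (power_measure mu n) setT measurableT
  (fun t => pi_W (fset_of_tuple t)).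
have h : (power_measure mu n).-integrable setT (fun t => pi_W (fset_of_tuple t)).
  apply/integrableP; split; first exact: mp.
  by under eq_integral do rewrite gee0_abs//.
move=> /(_ h); apply: filterS => t; exact.
Qed.

(** For every n, [fine] alters [pi_W] only on a null set of n-tuples, so no term of a set integral
    changes. *)
Lemma marginal_density :
  is_multiobject_density mu P (rfs_restr X mW) (fun Y => fine (pi_W Y)).
Proof.
have [p0 mp] := marginal_density_ge0_measurable.
split=> [Y|n|A mA]; first exact: fine_ge0.
  by apply: (measurableT_comp _ (mp n)); exact: fine_measurable.
rewrite marginal_set_integral//; apply: eq_eseriesr => n _; congr (_ * _).
apply: ge0_ae_eq_integral => //.
- exact: measurable_box.
- by apply: measurable_funTS; exact: mp.
- apply: measurable_funTS; apply/measurable_EFinP.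
  by apply: (measurableT_comp _ (mp n)); exact: fine_measurable.
- by move=> t _; rewrite lee_fin fine_ge0.
- by apply: filterS (marginal_density_ae_fin n) => t ft _; rewrite /= fineK.
Qed.

End marginal.

Unset Implicit Arguments.
Set Strict Implicit.

Theorem proposition1 (R : realType) (d : nat)
    (dO : measure_display) (Omega : measurableType dO)
    (P : probability Omega R)
    (X : {RV P >-> fin_subsets (euclidean R d)})
    (pi_X : {fset euclidean R d} -> R)
    (hpi_X : is_multiobject_density lebesgue P X pi_X)
    (W : set (euclidean R d)) (mW : measurable W)
    (pi_W : {fset euclidean R d} -> \bar R)
    (pi_WE : forall Y : {fset euclidean R d},
      pi_W Y = (\prod_(x <- Y) \1_W x)%:E *
               set_integral lebesgue (~` W)
                 (fun Y' : {fset euclidean R d} => (pi_X (Y `|` Y')%fset)%:E)) :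
  (forall n : nat, {ae power_measure lebesgue n,
     forall t, pi_W (fset_of_tuple t) \is a fin_num}) /\
  is_multiobject_density lebesgue P (rfs_restr X mW) (fun Y => fine (pi_W Y)).
Proof.
split; last
  exact: (@marginal_density _ _ _ lebesgue _ _ _ _ _ hpi_X _ mW _ pi_WE).
exact: (@marginal_density_ae_fin _ _ _ lebesgue _ _ _ _ _ hpi_X _ mW _ pi_WE).
Qed.
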